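(* Let $A$ be a regular ring containing a field of characteristic $p>0$, let $R=A[x_1,\ldots,x_m,y_1,\ldots,y_n]$ be standard bigraded over $A$, and let $M=\bigoplus_{(i,j)\in\mathbb{Z}^2}M_{(i,j)}$ be a bigraded $F_R$-finite $F_R$-module. Then: (1) The following are equivalent: (a) $M_{(a,b)}\neq0$ for all $(a,b)\in\mathbb{Z}^2$; (b) there exists some $(a_0,b_0)\in\mathbb{Z}^2$ with $(-m,-n)<(a_0,b_0)<(0,0)$, that is, $-m<a_0<0$ and $-n<b_0<0$, such that $M_{(a_0,b_0)}\neq0$. (2) The following are equivalent: (a) $M_{(a,b)}\neq0$ for all $(a,b)\in\mathbb{Z}^2$ with $b\geq0$; (b) there exists some $(a_0,b_0)\in\mathbb{Z}^2$ with $-m<a_0<0$ and $b_0\geq0$ such that $M_{(a_0,b_0)}\neq0$. (3) The following are equivalent: (a) $M_{(a,b)}\neq0$ for all $(a,b)\in\mathbb{Z}^2$ with $a\leq-m$; (b) there exists some $(a_0,b_0)\in\mathbb{Z}^2$ with $a_0\leq-m$ and $-n<b_0<0$ such that $M_{(a_0,b_0)}\neq0$. (4) The following are equivalent: (a) $M_{(a,b)}\neq0$ for all $(a,b)\in\mathbb{Z}^2$ with $b\leq-n$; (b) there exists some $(a_0,b_0)\in\mathbb{Z}^2$ with $-m<a_0<0$ and $b_0\leq-n$ such that $M_{(a_0,b_0)}\neq0$. (5) The following are equivalent: (a) $M_{(a,b)}\neq0$ for all $(a,b)\in\mathbb{Z}^2$ with $a\geq0$; (b) there exists some $(a_0,b_0)\in\mathbb{Z}^2$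 with $a_0\geq0$ and $-n<b_0<0$ such that $M_{(a_0,b_0)}\neq0$.
   Context: Rings are commutative and Noetherian. Standard bigraded means: elements of $A$ have bidegree $(0,0)$, each $x_i$ has bidegree $(1,0)$, each $y_j$ has bidegree $(0,1)$. For an $R$-module $M$, $F_R(M)={}^{1}R\otimes_R M$, where ${}^{1}R$ is $R$ with its usual left $R$-module structure and right structure $r'\cdot r=r^{p}r'$ (so $a\otimes rm=ar^p\otimes m$). If $M$ is bigraded, $F_R(M)$ is bigraded by $\operatorname{bideg}(r'\otimes m)=\operatorname{bideg}(r')+p\operatorname{bideg}(m)$ for homogeneous $r'$ and $m$. An $F_R$-module is an $R$-module $M$ with an $R$-module isomorphism $\theta:M\to F_R(M)$; it is bigraded if $M$ is bigraded and $\theta$ preserves bidegree. A generating morphism of $M$ is an injective $R$-linear map $\beta:U\to F_R(U)$, with $U$ an $R$-module, such that $M=\varinjlim(U\xrightarrow{\beta}F_R(U)\xrightarrow{F_R(\beta)}F_R^2(U)\to\cdots)$ with $\theta$ induced by the maps $F_R^e(\beta)$. $M$ is $F_R$-finite if it has a generating morphism with $U$ a finitely generated $R$-module; it is a bigraded $F_R$-finite $F_R$-module if in addition $M$ (and $U$) are bigraded and $\beta$ preserves bidegree.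
   Formalization: Takes m,n ≥ 1; parts (1),(2),(4) assume m ≥ 2 and parts (1),(3),(5) assume n ≥ 2, since for m=1 or n=1 the range in (b) is empty while M=R_{x_1y_1} satisfies (a), so the stated equivalence fails. *)

(* Defs.v *)
From HB Require Import structures.
From mathcomp Require Import all_boot all_order all_algebra.
From mathcomp Require Import boolp.
From mathcomp Require Import freeg mpoly.

Set Implicit Arguments.
Unset Strict Implicit.
Unset Printing Implicit Defensive.

Import GRing.Theory.
Local Open Scope ring_scope.
Local Open Scope quotient_scope.

Section Regular.
Variable A : comNzRingType.

Definition ideal_gen (s : seq A) (a : A) : Prop :=
  exists c : 'I_(size s) -> A, a = \sum_i c i * s`_i.

(* [idealr] is the type of proper ideals; the unit ideal is generated by 1, so
   it need not be considered. *)
Definition noetherian : Prop :=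
  forall I : idealr A, exists s : seq A, forall a, a \in I <-> ideal_gen s a.

Definition maximal_ideal (I : idealr A) : Prop :=
  forall J : idealr A, {subset I <= J} -> {subset J <= I}.

Definition has_prime_chain (d : nat) : Prop :=
  exists P : nat -> prime_idealr A, forall i, (i < d)%N ->
    {subset P i <= P i.+1} /\ ~ {subset P i.+1 <= P i}.

Definition krull_dim (d : nat) : Prop :=
  has_prime_chain d /\ forall e, has_prime_chain e -> (e <= d)%N.

Definition regular_local : Prop :=
  noetherian /\
  exists I : idealr A,
    [/\ maximal_ideal I,
        forall J : idealr A, maximal_ideal J -> J =i I
      & exists (d : nat) (s : d.-tuple A),
          krull_dim d /\ forall a, a \in I <-> ideal_gen s a].

(* [f] exhibits [B] as the ring of fractions of [A] with denominators outside
   [P]. *)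
Definition is_localization (P : prime_idealr A) (B : comNzRingType)
    (f : {rmorphism A -> B}) : Prop :=
  [/\ forall s, s \notin P -> exists t, f s * t = 1,
      forall b, exists a s, s \notin P /\ b * f s = f a
    & forall a, f a = 0 <-> exists2 s, s \notin P & s * a = 0].

End Regular.

Definition regular_ring (A : comNzRingType) : Prop :=
  noetherian A /\
  forall P : prime_idealr A,
    exists (B : comNzRingType) (f : {rmorphism A -> B}),
      is_localization P f /\ regular_local B.

Section Frobenius.
Variables (p : nat) (R : comNzRingType).

Section Module.
Variable M : lmodType R.

(* The bilinearity relations of the tensor product, on formal sums of symbols
   <<a *g u>> standing for a (x) u; additivity in [a] holds already in
   {freeg M / R}. *)
Inductive frob_rel : {freeg M / R} -> Prop :=
| frob_rel0 : frob_rel 0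
| frob_relB x y : frob_rel x -> frob_rel y -> frob_rel (x - y)
| frob_rel_add a u v :
    frob_rel (<< a *g (u + v) >> - << a *g u >> - << a *g v >>)
| frob_rel_bal a r u :
    frob_rel (<< a *g (r *: u) >> - << a * r ^+ p *g u >>).

Definition frob_relb : {pred {freeg M / R}} := fun x => `[< frob_rel x >].

Lemma frob_relb_zmod : zmod_closed frob_relb.
Proof.
split; first by apply/asboolP; exact: frob_rel0.
by move=> x y /asboolP ? /asboolP ?; apply/asboolP; exact: frob_relB.
Qed.

HB.instance Definition _ :=
  GRing.isZmodClosed.Build {freeg M / R} frob_relb frob_relb_zmod.

Definition Frob : Type := Quotient.quot frob_relb.

HB.instance Definition _ := GRing.Zmodule.on Frob.

Definition frob_proj (x : {freeg M / R}) : Frob := \pi_(Quotient.quot frob_relb) x.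

Definition tens (a : R) (u : M) : Frob := frob_proj << a *g u >>.

Lemma frob_projP x y : frob_proj x = frob_proj y <-> frob_rel (x - y).
Proof.
split.
  by move/eqP; rewrite /frob_proj -Quotient.idealrBE => /asboolP.
by move=> h; apply/eqP; rewrite -Quotient.idealrBE; apply/asboolP.
Qed.

Lemma frob_projK (z : Frob) : frob_proj (repr (z : Quotient.quot frob_relb)) = z.
Proof. exact: reprK. Qed.

Lemma frob_projD x y : frob_proj (x + y) = frob_proj x + frob_proj y.
Proof. exact: (raddfD \pi_(Quotient.quot frob_relb)). Qed.

Lemma freeg_scaleU (c a : R) (u : M) :
  c *: << a *g u >> = << c * a *g u >> :> {freeg M / R}.
Proof.
apply/eqP/freeg_eqP => v.
by rewrite coeff_fgscale !coeffU mulrA.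
Qed.

Lemma frob_relZ c x : frob_rel x -> frob_rel (c *: x).
Proof.
elim=> [|{}x y _ ihx _ ihy|a u v|a r u]; first by rewrite scaler0; exact: frob_rel0.
- by rewrite scalerBr; apply: frob_relB.
- by rewrite !scalerBr !freeg_scaleU; apply: frob_rel_add.
- by rewrite scalerBr !freeg_scaleU mulrA; apply: frob_rel_bal.
Qed.

Definition frob_scale (c : R) (z : Frob) : Frob :=
  frob_proj (c *: repr (z : Quotient.quot frob_relb)).

Lemma frob_scaleE c x : frob_scale c (frob_proj x) = frob_proj (c *: x).
Proof.
apply/frob_projP; rewrite -scalerBr; apply: frob_relZ.
by apply/frob_projP; rewrite frob_projK.
Qed.

Lemma frob_scaleA a b z : frob_scale a (frob_scale b z) = frob_scale (a * b) z.
Proof. by rewrite -[z]frob_projK !frob_scaleE scalerA. Qed.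

Lemma frob_scale1 : left_id 1 frob_scale.
Proof. by move=> z; rewrite -[z]frob_projK frob_scaleE scale1r. Qed.

Lemma frob_scaleDr : right_distributive frob_scale +%R.
Proof.
move=> a z t; rewrite -[z]frob_projK -[t]frob_projK -frob_projD !frob_scaleE.
by rewrite scalerDr frob_projD.
Qed.

Lemma frob_scaleDl z : {morph frob_scale^~ z : a b / a + b}.
Proof.
by move=> a b; rewrite -[z]frob_projK !frob_scaleE scalerDl frob_projD.
Qed.

HB.instance Definition _ := GRing.Zmodule_isLmodule.Build R Frob
  frob_scaleA frob_scale1 frob_scaleDr frob_scaleDl.

End Module.

Section Lift.
Variables (M N : lmodType R) (g : M -> N).
Hypothesis gD : forall u v, g (u + v) = g u + g v.
Hypothesis gZ : forall r u, g (r *: u) = r ^+ p *: g u.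

Definition frob_lift (z : Frob M) : N :=
  fglift g (repr (z : Quotient.quot (@frob_relb M))).

Lemma fgliftB x y : fglift g (x - y) = fglift g x - fglift g y.
Proof. exact: lift_is_additive. Qed.

Lemma fglift0 : fglift g 0 = 0.
Proof. by rewrite -(subrr (0 : {freeg M / R})) fgliftB subrr. Qed.

Lemma fgliftD x y : fglift g (x + y) = fglift g x + fglift g y.
Proof. by rewrite -[y]opprK fgliftB -(sub0r (- y)) fgliftB fglift0 sub0r. Qed.

Lemma fgliftZ c x : fglift g (c *: x) = c *: fglift g x.
Proof.
rewrite -[x]freeg_sumE; elim: (dom x) => [|u s ih].
  by rewrite big_nil scaler0 fglift0 scaler0.
by rewrite big_cons scalerDr !fgliftD ih scalerDr freeg_scaleU !liftU scalerA.
Qed.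

Lemma fglift_rel x : frob_rel x -> fglift g x = 0.
Proof.
elim=> [|{}x y _ hx _ hy|a u v|a r u]; first exact: fglift0.
- by rewrite fgliftB hx hy subrr.
- by rewrite !fgliftB !liftU gD scalerDr -addrA -opprD subrr.
- by rewrite fgliftB !liftU gZ scalerA subrr.
Qed.

Lemma frob_lift_proj x : frob_lift (frob_proj x) = fglift g x.
Proof.
apply/eqP; rewrite -subr_eq0 -fgliftB; apply/eqP/fglift_rel/frob_projP.
by rewrite frob_projK.
Qed.

Lemma frob_lift_is_linear : linear frob_lift.
Proof.
move=> c z t; rewrite -[z]frob_projK -[t]frob_projK.
rewrite [c *: _]frob_scaleE -frob_projD !frob_lift_proj.
by rewrite fgliftD fgliftZ.
Qed.

Lemma frob_lift_tens a u : frob_lift (tens a u) = a *: g u.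
Proof. by rewrite frob_lift_proj liftU. Qed.

End Lift.

Section Tens.
Variable M : lmodType R.

Lemma tensDr a (u v : M) : tens a (u + v) = tens a u + tens a v.
Proof.
rewrite -frob_projD; apply/frob_projP.
by rewrite opprD addrA; apply: frob_rel_add.
Qed.

Lemma tensZr a r (u : M) : tens a (r *: u) = tens (a * r ^+ p) u.
Proof. by apply/frob_projP; apply: frob_rel_bal. Qed.

Lemma tensDl a b (u : M) : tens (a + b) u = tens a u + tens b u.
Proof. by rewrite -frob_projD freegUD. Qed.

Lemma tensZl c a (u : M) : tens (c * a) u = c *: tens a u.
Proof. by rewrite [RHS]frob_scaleE freeg_scaleU. Qed.

End Tens.

Section Map.
Variables (M N : lmodType R) (f : {linear M -> N}).

Definition frob_map : Frob M -> Frob N := frob_lift (fun u => tens 1 (f u)).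

Lemma frob_map_is_linear : linear frob_map.
Proof.
apply: frob_lift_is_linear => [u v|r u]; first by rewrite linearD tensDr.
by rewrite linearZ /= tensZr mulrC tensZl.
Qed.

HB.instance Definition _ :=
  GRing.isLinear.Build R (Frob M) (Frob N) *:%R frob_map frob_map_is_linear.

Lemma frob_map_tens a u : frob_map (tens a u) = tens a (f u).
Proof.
rewrite /frob_map frob_lift_tens => [|v w|r v]; first by rewrite -tensZl mulr1.
  by rewrite linearD tensDr.
by rewrite linearZ /= tensZr mulrC tensZl.
Qed.

End Map.

Definition fin_gen (U : lmodType R) : Prop :=
  exists s : seq U, forall u,
    exists c : 'I_(size s) -> R, u = \sum_i c i *: s`_i.

Definition is_direct_limit (X : nat -> lmodType R)
    (t : forall e, {linear X e -> X e.+1})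
    (M : lmodType R) (psi : forall e, {linear X e -> M}) : Prop :=
  (forall e u, psi e.+1 (t e u) = psi e u) /\
  forall (N : lmodType R) (phi : forall e, {linear X e -> N}),
    (forall e u, phi e.+1 (t e u) = phi e u) ->
    exists2 h : {linear M -> N}, forall e u, h (psi e u) = phi e u
      & forall h' : {linear M -> N},
          (forall e u, h' (psi e u) = phi e u) -> h' =1 h.

Definition frob_iter (U : lmodType R) (e : nat) : lmodType R :=
  iter e (fun V : lmodType R => Frob V : lmodType R) U.

Fixpoint frob_iter_map (U : lmodType R) (beta : {linear U -> Frob U}) (e : nat) :
    {linear frob_iter U e -> frob_iter U e.+1} :=
  if e is e'.+1 then frob_map (frob_iter_map beta e') else beta.

(* [theta] is induced by the maps F^e(beta): on the image of the e-th stage it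
   is F^e(beta) followed by the canonical map F(F^e(U)) -> F(M). *)
Definition generating_morphism (M : lmodType R) (theta : {linear M -> Frob M})
    (U : lmodType R) (beta : {linear U -> Frob U}) : Prop :=
  injective beta /\
  exists psi : forall e, {linear frob_iter U e -> M},
    is_direct_limit (frob_iter_map beta) psi /\
    forall e u, theta (psi e u) = frob_map (psi e) (frob_iter_map beta e u).

End Frobenius.

Arguments Frob p {R} M.
Arguments tens p {R M} a u.

Section Bigraded.
Variables (m n : nat) (A : comNzRingType).
Local Notation R := {mpoly A[m + n]}.

(* The variables 'X_(lshift n i) are the x's and 'X_(rshift m j) the y's. *)
Definition mnm_bideg (mu : 'X_{1..m + n}) : int * int :=
  ((\sum_(i < m) mu (lshift n i))%N%:Z, (\sum_(j < n) mu (rshift m j))%N%:Z).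

Definition bihomog (d : int * int) (f : R) : Prop :=
  forall mu, mu \in msupp f -> mnm_bideg mu = d.

Definition is_bigrading (M : lmodType R) (G : int * int -> M -> Prop) : Prop :=
  [/\ forall d, G d 0 /\ (forall u v, G d u -> G d v -> G d (u - v)),
      forall d e (f : R) u, bihomog d f -> G e u -> G (d + e) (f *: u),
      forall u, exists (s : seq (int * int)) (c : int * int -> M),
        (forall d, G d (c d)) /\ u = \sum_(d <- s) c d
    & forall (s : seq (int * int)) (c : int * int -> M),
        uniq s -> (forall d, G d (c d)) -> \sum_(d <- s) c d = 0 ->
        forall d, d \in s -> c d = 0].

Definition preserves_bideg (M N : Type)
    (G : int * int -> M -> Prop) (H : int * int -> N -> Prop) (f : M -> N) :=
  forall d u, G d u -> H d (f u).

(* The component of F_R(M) of bidegree d: finite sums of elements a (x) u with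
   a and u homogeneous and bideg a + p bideg u = d. *)
Definition frob_bigrading (p : nat) (M : lmodType R)
    (G : int * int -> M -> Prop) (d : int * int) (z : Frob p M) : Prop :=
  exists (k : nat) (a : 'I_k -> R) (u : 'I_k -> M),
    z = \sum_i tens p (a i) (u i) /\
    forall i, exists d1 d2 : int * int,
      [/\ bihomog d1 (a i), G d2 (u i) & d1 + d2 *+ p = d].

Record bigraded_F_finite (p : nat) (M : lmodType R)
    (theta : {linear M -> Frob p M}) (G : int * int -> M -> Prop) : Prop := {
  F_module_iso : bijective theta;
  F_module_bigrading : is_bigrading G;
  F_module_iso_bideg : preserves_bideg G (@frob_bigrading p M G) theta;
  F_module_generator : exists (U : lmodType R) (beta : {linear U -> Frob p U})
      (H : int * int -> U -> Prop),
    [/\ fin_gen U, is_bigrading H, generating_morphism theta beta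
      & preserves_bideg H (@frob_bigrading p U H) beta]
}.

Definition component_neq0 (M : lmodType R) (G : int * int -> M -> Prop)
    (a b : int) : Prop :=
  exists2 u, G (a, b) u & u <> 0.

End Bigraded.

(* Main.v *)
Require Import Defs.
From HB Require Import structures.
From mathcomp Require Import all_boot all_order all_algebra.
From mathcomp Require Import boolp.
From mathcomp Require Import freeg mpoly.
From mathcomp Require Import zify ring.

Set Implicit Arguments.
Unset Strict Implicit.
Unset Printing Implicit Defensive.

Import Order.TTheory GRing.Theory Num.Theory.
Local Open Scope ring_scope.

(* Transporting u |-> 1 (x) u along theta gives a p-linear map phi : M -> M that
   multiplies bidegrees by p.  With q = p ^ k, every element of M_d is a sum of
   terms b x^alpha phi^k(u) with b in A, all exponents of alpha below q and
   bideg(alpha) + q bideg(u) = d; conversely x^alpha phi^k(u) <> 0 as soon as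
   phi^k(u) <> 0, because R is free over p^k-th powers of the variables.  So
   M_d <> 0 iff for each (equivalently, some) k there is a bidegree e with
   phi^k(M_e) <> 0 and 0 <= d_i - q e_i <= m_i (q - 1) in both coordinates.
   For k large these windows force e into the finite box [-m, 0] x [-n, 0], so
   by pigeonhole a single e has phi^k(M_e) <> 0 for all k.  Such an e makes M_d
   nonzero for all d whose windows eventually contain e, and the five statements
   follow. *)

(** * Additive maps given as bare functions *)

Section Additive.
Variables (U V : zmodType) (f : U -> V).
Hypothesis fD : forall x y, f (x + y) = f x + f y.

Lemma addmap0 : f 0 = 0.
Proof. by apply: (addrI (f 0)); rewrite -fD !addr0. Qed.

Lemma addmapN x : f (- x) = - f x.
Proof. by apply/eqP; rewrite -addr_eq0 -fD addNr addmap0. Qed.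

Lemma addmap_sum (I : Type) (s : seq I) (P : pred I) (F : I -> U) :
  f (\sum_(i <- s | P i) F i) = \sum_(i <- s | P i) f (F i).
Proof.
elim: s => [|i s ih]; first by rewrite !big_nil addmap0.
by rewrite !big_cons; case: (P i) => //; rewrite fD ih.
Qed.

End Additive.

(** * Additive maps out of formal sums *)

Section FreegSum.
Variables (G : nzRingType) (K : choiceType) (N : zmodType) (h : G -> K -> N).
Hypothesis hD : forall a b v, h (a + b) v = h a v + h b v.

(** Unlike [fglift], this asks only that [h] be additive in the coefficient and that the target be
    an abelian group. *)
Definition freeg_sum (x : {freeg K / G}) : N := \sum_(v <- dom x) h (coeff v x) v.

Lemma freeg_sum_sub (s : seq K) (x : {freeg K / G}) : uniq s ->
  {subset dom x <= s} -> freeg_sum x = \sum_(v <- s) h (coeff v x) v.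
Proof.
move=> us sub; rewrite /freeg_sum [RHS](bigID (mem (dom x))) /=.
rewrite [X in _ + X]big1 ?addr0 => [|v vx].
  rewrite -[RHS]big_filter; apply: perm_big; apply: uniq_perm.
  - exact: uniq_dom.
  - exact: filter_uniq.
  - move=> v; rewrite mem_filter; case: (boolP (v \in dom x)) => // vx.
    by rewrite /= (sub _ vx).
by rewrite (coeff_outdom vx) (addmap0 (fun a b => hD a b v)).
Qed.

Lemma freeg_sumD x y : freeg_sum (x + y) = freeg_sum x + freeg_sum y.
Proof.
pose s := undup (dom x ++ dom y).
have us : uniq s by exact: undup_uniq.
have sub z : {subset dom z <= dom x ++ dom y} -> {subset dom z <= s}.
  by move=> h1 v /h1; rewrite mem_undup.
rewrite !(freeg_sum_sub us); first last.
- by apply: sub => v; exact: domD_subset.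
- by apply: sub => v; rewrite mem_cat => ->.
- by apply: sub => v; rewrite mem_cat => ->; rewrite orbT.
by rewrite -big_split /=; apply: eq_bigr => v _; rewrite coeffD hD.
Qed.

Lemma freeg_sumU a v : freeg_sum << a *g v >> = h a v.
Proof.
rewrite (@freeg_sum_sub [:: v]) ?big_seq1 ?coeffU ?eqxx ?mulr1 // => w.
rewrite mem_dom coeffU inE (eq_sym w); case: (v =P w) => //= _.
by rewrite mulr0n mulr0 eqxx.
Qed.

End FreegSum.

(** * Additive maps out of the Frobenius functor *)

Section FrobLift.
Variables (p : nat) (R : comNzRingType) (M : lmodType R) (N : zmodType).
Variable h : R -> M -> N.
Hypothesis hDl : forall a b u, h (a + b) u = h a u + h b u.
Hypothesis hDr : forall a u v, h a (u + v) = h a u + h a v.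
Hypothesis hbal : forall a r u, h a (r *: u) = h (a * r ^+ p) u.

(** The universal property of the tensor product for balanced biadditive maps. [frob_lift] yields
    only R-linear maps, while the extraction maps built later are merely additive. *)
Lemma frob_additive_lift : exists L : Frob p M -> N,
  (forall z t, L (z + t) = L z + L t) /\ forall a u, L (tens p a u) = h a u.
Proof.
pose S := @freeg_sum R M N h.
have SD : forall x y, S (x + y) = S x + S y by exact: freeg_sumD.
have S0 (x : {freeg M / R}) : frob_rel p x -> S x = 0.
  elim=> [|{}x y _ hx _ hy|a u v|a r u].
  - exact: addmap0 SD.
  - by rewrite SD (addmapN SD) hx hy subrr.
  - by rewrite !SD !(addmapN SD) /S !freeg_sumU // hDr -addrA -opprD subrr.
  - by rewrite SD (addmapN SD) /S !freeg_sumU // hbal subrr.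
pose L (z : Frob p M) := S (repr (z : Quotient.quot (@frob_relb p R M))).
have LE x : L (frob_proj p x) = S x.
  apply/eqP; rewrite -subr_eq0 -(addmapN SD) -SD; apply/eqP/S0/frob_projP.
  by rewrite frob_projK.
exists L; split=> [z t|a u]; last by rewrite LE /S freeg_sumU.
by rewrite -[z]frob_projK -[t]frob_projK -frob_projD !LE SD.
Qed.

End FrobLift.

(** * The p-linear map and its iterates *)

Section FrobeniusStructure.
Variables (p : nat) (R : comNzRingType) (M : lmodType R).
Hypothesis charR : p \in [pchar R].
Variables (theta : {linear M -> Frob p M}) (phi : M -> M).
Hypothesis theta_inj : injective theta.
Hypothesis theta_phi : forall u, theta (phi u) = tens p 1 u.

Local Notation phi_ k := (iter k phi).

Lemma expr_pcharD k (a b : R) : (a + b) ^+ (p ^ k) = a ^+ (p ^ k) + b ^+ (p ^ k).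
Proof.
elim: k => [|k ih]; first by rewrite expn0 !expr1.
by rewrite expnSr !exprM ih -!(pFrobenius_autE charR) rmorphD.
Qed.

Lemma theta_scale_phi a u : theta (a *: phi u) = tens p a u.
Proof. by rewrite linearZ /= theta_phi -tensZl mulr1. Qed.

Lemma iter_phiD k u v : phi_ k (u + v) = phi_ k u + phi_ k v.
Proof.
elim: k => //= k ->; apply: theta_inj.
by rewrite linearD /= !theta_phi tensDr.
Qed.

Lemma iter_phiZ k r u : phi_ k (r *: u) = r ^+ (p ^ k) *: phi_ k u.
Proof.
elim: k => [|k /= ->]; first by rewrite expn0 expr1.
apply: theta_inj; rewrite theta_phi theta_scale_phi tensZr mul1r.
by rewrite -exprM expnSr.
Qed.

(** Every [theta u] is a sum of tensors a (x) v = theta (a phi(v)), so injectivity of [theta] writes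
    u as a sum of terms a phi(v). *)
Lemma phi_span (Q : M -> Prop) : Q 0 -> (forall u v, Q u -> Q v -> Q (u + v)) ->
  (forall a u, Q (a *: phi u)) -> forall u, Q u.
Proof.
move=> Q0 QD Qphi u.
have [x thx] : exists x, theta u = frob_proj p x.
  by exists (repr (theta u : Quotient.quot (@frob_relb p R M))); rewrite frob_projK.
have {u thx} -> : u = \sum_(v <- dom x) coeff v x *: phi v.
  apply: theta_inj; rewrite thx linear_sum /=.
  rewrite -[in LHS](freeg_sumE x) (addmap_sum (@frob_projD p R M)).
  by apply: eq_bigr => v _; rewrite theta_scale_phi.
by elim/big_rec: _ => // v w _ Qw; apply: QD.
Qed.

(** Iterating [theta] identifies M with F^k(M), a phi^k(u) corresponding to a (x) u; this is the
    universal property of F^k(M) read on M. *)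
Lemma phi_iter_lift k (N : zmodType) (h : R -> M -> N) :
  (forall a b u, h (a + b) u = h a u + h b u) ->
  (forall a u v, h a (u + v) = h a u + h a v) ->
  (forall a r u, h a (r *: u) = h (a * r ^+ (p ^ k)) u) ->
  exists L : M -> N, (forall u v, L (u + v) = L u + L v) /\
    forall a u, L (a *: phi_ k u) = h a u.
Proof.
elim: k h => [|k ih] h hDl hDr hbal.
  exists (h 1); split=> // a u.
  by rewrite hbal mul1r expn0 expr1.
(* Peel off the innermost phi with a fixed: a phi^k(b phi(u)) = a b^(p^k) phi^(k+1)(u) dictates the
   values of [La]. *)
have level1 a : exists La : M -> N, (forall u v, La (u + v) = La u + La v) /\
    forall b u, La (b *: phi u) = h (a * b ^+ (p ^ k)) u.
  have [||b r u|L [LD LT]] := @frob_additive_lift p R M N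
      (fun b u => h (a * b ^+ (p ^ k)) u).
  - by move=> b c u; rewrite expr_pcharD mulrDr hDl.
  - by move=> b u v; rewrite hDr.
  - by rewrite hbal exprMn -exprM -expnS mulrA.
  exists (L \o theta); split=> [u v|b u] /=; first by rewrite linearD LD.
  by rewrite theta_scale_phi LT.
have [L1 L1P] := choice level1.
have L1D a u v : L1 a (u + v) = L1 a u + L1 a v by case: (L1P a).
have L1E a b u : L1 a (b *: phi u) = h (a * b ^+ (p ^ k)) u by case: (L1P a).
(* The additivity and balance of [L1] are known only on terms c phi(u); [phi_span] extends them to
   M. *)
have [a b|//|a r|L [LD LE]] := ih L1.
- apply: phi_span => [|u v hu hv|c u].
  + by rewrite !(addmap0 (L1D _)) addr0.
  + by rewrite !L1D hu hv addrACA.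
  + by rewrite !L1E mulrDl hDl.
- apply: phi_span => [|u v hu hv|c u].
  + by rewrite scaler0 !(addmap0 (L1D _)).
  + by rewrite scalerDr !L1D hu hv.
  + by rewrite scalerA !L1E exprMn mulrA.
exists L; split=> // a u.
by rewrite iterSr LE -[phi u]scale1r L1E expr1n mulr1.
Qed.

End FrobeniusStructure.

(** * Additive maps prescribed on monomial multiples of iterates *)

Section MonomialLift.
Variables (p l : nat) (A : comNzRingType).
Local Notation R := {mpoly A[l]}.
Variable M : lmodType R.
Hypothesis charR : p \in [pchar R].
Variables (theta : {linear M -> Frob p M}) (phi : M -> M).
Hypothesis theta_inj : injective theta.
Hypothesis theta_phi : forall u, theta (phi u) = tens p 1 u.

Lemma mpoly_scaleE (N : lmodType R) (a : R) (u : N) :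
  a *: u = \sum_(mu <- msupp a) (a@_mu)%:MP *: ('X_[mu] *: u).
Proof.
rewrite {1}[a]mpolyE scaler_suml; apply: eq_bigr => mu _.
by rewrite scalerA mul_mpolyC.
Qed.

(** Since R is free over A on the monomials, a map on the terms a phi^k(u) may be prescribed
    exponent by exponent. The hypotheses on [H] are balance for constants and for monomials. *)
Lemma monomial_lift k (N : lmodType R) (H : 'X_{1..l} -> M -> N) :
  (forall mu u v, H mu (u + v) = H mu u + H mu v) ->
  (forall mu b u, H mu (b%:MP *: u) = b%:MP ^+ (p ^ k) *: H mu u) ->
  (forall mu nu u, H mu ('X_[nu] *: u) = H (mu + nu *+ (p ^ k))%MM u) ->
  exists L : M -> N, (forall u v, L (u + v) = L u + L v) /\
    forall b mu u, L (b%:MP *: ('X_[mu] *: iter k phi u)) = b%:MP *: H mu u.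
Proof.
set q := (p ^ k)%N => HD HC HX.
pose h (a : R) (u : M) := freeg_sum (fun (c : A) mu => c%:MP *: H mu u) a.
have hDl a b u : h (a + b) u = h a u + h b u.
  by apply: freeg_sumD => c d mu; rewrite mpolyCD scalerDl.
have hDr a u v : h a (u + v) = h a u + h a v.
  by rewrite -big_split; apply: eq_bigr => mu _; rewrite HD scalerDr.
have hX c mu u : h (c%:MP * 'X_[mu]) u = c%:MP *: H mu u.
  rewrite -(@freeg_sumU _ _ _ (fun (c : A) mu => c%:MP *: H mu u)).
    congr freeg_sum; apply/eqP/freeg_eqP => nu.
    rewrite -[LHS]/((c%:MP * 'X_[mu])@_nu).
    by rewrite mul_mpolyC mcoeffZ mcoeffX coeffU.
  by move=> ? ? ?; rewrite mpolyCD scalerDl.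
have charD (a b : R) : (a + b) ^+ q = a ^+ q + b ^+ q := expr_pcharD charR k a b.
(* As q-th powers are additive in characteristic p, both a and r may be taken to be single terms. *)
have hbal a r u : h a (r *: u) = h (a * r ^+ q) u.
  rewrite mpoly_scaleE (addmap_sum (hDr a)) [in RHS](mpolyE r) (addmap_sum charD).
  rewrite mulr_sumr (addmap_sum (fun a b => hDl a b u)); apply: eq_bigr => nu _.
  rewrite [a]mpolyE mulr_suml !(addmap_sum (fun a b => hDl a b _)).
  apply: eq_bigr => mu _; rewrite -!mul_mpolyC hX HC HX.
  have bX : (r@_nu)%:MP ^+ q = (r@_nu ^+ q)%:MP :> R by rewrite rmorphXn.
  rewrite scalerA bX -mpolyCM -hX; congr h.
  by rewrite exprMn mpolyXn mpolyXD mpolyCM bX; ring.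
have [L [LD LE]] := phi_iter_lift charR theta_inj theta_phi hDl hDr hbal.
by exists L; split=> // b mu u; rewrite scalerA LE hX.
Qed.

(* Extracting the part of exponents congruent to [alpha] modulo [p ^ k]: the
   monomials with exponents below [p ^ k] are independent over p^k-th powers. *)
Lemma scaleX_iter_phi_eq0 k (alpha : 'X_{1..l}) u :
  (forall i, alpha i < p ^ k)%N ->
  'X_[alpha] *: iter k phi u = 0 -> iter k phi u = 0.
Proof.
set q := (p ^ k)%N => lt_alpha eq0.
pose quo (mu : 'X_{1..l}) : 'X_{1..l} := [multinom (mu i %/ q)%N | i < l].
(* For mu = alpha + q nu this divides by x^alpha and turns x^(q nu) phi^k(v) into phi^k(x^nu v). *)
pose H (mu : 'X_{1..l}) v := if [forall i, mu i %% q == alpha i]%N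
  then iter k phi ('X_[quo mu] *: v) else 0.
have phD := iter_phiD theta_inj theta_phi k.
have phZ := iter_phiZ theta_inj theta_phi k.
have [mu v w|mu b v|mu nu v|L [LD LE]] := @monomial_lift k M H.
- by rewrite /H; case: ifP; rewrite ?addr0 // scalerDr phD.
- by rewrite /H; case: ifP; rewrite ?scaler0 // scalerA mulrC -scalerA phZ.
- have q_gt0 : (0 < q)%N by rewrite expn_gt0 prime_gt0 // (pcharf_prime charR).
  rewrite /H; have -> : [forall i, (mu + nu *+ q)%MM i %% q == alpha i]%N =
      [forall i, mu i %% q == alpha i]%N.
    by apply: eq_forallb => i; rewrite mnmDE mulmnE addnC modnMDl.
  case: ifP => // _; congr (iter k phi); rewrite scalerA -mpolyXD; congr ('X_[_] *: _).
  by apply/mnmP => i; rewrite mnmDE !mnmE mulmnE -/q [in RHS]addnC divnMDl // addnC.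
(* [L] sends x^alpha phi^k(u), which is 0 by hypothesis, to phi^k(u). *)
have := LE 1 alpha u; rewrite !scale1r eq0 (addmap0 LD) /H.
have -> : [forall i, alpha i %% q == alpha i]%N.
  by apply/forallP => i; rewrite modn_small.
have -> : quo alpha = 0%MM by apply/mnmP => i; rewrite mnmE mnm0E divn_small.
by rewrite mpolyX0 scale1r.
Qed.

End MonomialLift.

(** * Arithmetic of bidegrees *)

Lemma pair_mulrn (U V : zmodType) (x : U * V) k : x *+ k = (x.1 *+ k, x.2 *+ k).
Proof. by elim: k => [|k ih]; rewrite ?mulr0n // !mulrS ih. Qed.

Lemma divz_addMn (p : nat) (x y : int) : (0 < p)%N ->
  ((x + y *+ p) %/ p)%Z = (x %/ p)%Z + y.
Proof. by move=> p_gt0; rewrite -mulr_natr natz divzDr ?mulzK ?dvdz_mull //; lia. Qed.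

Section Bidegree.
Variables m n : nat.
Implicit Types mu nu : 'X_{1..m + n}.

Lemma mnm_bideg0 : mnm_bideg (0%MM : 'X_{1..m + n}) = 0.
Proof. by congr pair; congr Posz; apply: big1 => i _; rewrite mnm0E. Qed.

Lemma mnm_bidegD mu nu : mnm_bideg (mu + nu)%MM = mnm_bideg mu + mnm_bideg nu.
Proof.
by congr pair; rewrite -PoszD -big_split; congr Posz; apply: eq_bigr => i _;
  rewrite mnmDE.
Qed.

Lemma mnm_bidegMn mu k : mnm_bideg (mu *+ k)%MM = mnm_bideg mu *+ k.
Proof.
elim: k => [|k ih].
  by congr pair; congr Posz; apply: big1 => i _; rewrite mulmnE muln0.
rewrite mulrS -ih -mnm_bidegD; congr mnm_bideg; apply/mnmP => i.
by rewrite mnmDE !mulmnE mulnS.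
Qed.

Lemma bihomogX (A : comNzRingType) mu :
  bihomog (mnm_bideg mu) ('X_[mu] : {mpoly A[m + n]}).
Proof. by move=> nu; rewrite msuppX inE => /eqP ->. Qed.

Lemma bihomogC (A : comNzRingType) (b : A) : bihomog 0 (b%:MP : {mpoly A[m + n]}).
Proof.
move=> nu; rewrite msuppC; case: ifP => // _; rewrite inE => /eqP ->.
exact: mnm_bideg0.
Qed.

End Bidegree.

(** * Homogeneous components of a bigraded module *)

Section Components.
Variables (m n : nat) (A : comNzRingType).
Local Notation R := {mpoly A[m + n]}.
Variables (M : lmodType R) (G : int * int -> M -> Prop).
Hypothesis Ggr : is_bigrading G.

Lemma bigrading0 d : G d 0.
Proof. by case: Ggr => /(_ d) []. Qed.

Lemma bigradingB d u v : G d u -> G d v -> G d (u - v).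
Proof. by case: Ggr => /(_ d) [_ h] _ _ _; apply: h. Qed.

Lemma bigradingN d u : G d u -> G d (- u).
Proof. by move=> hu; rewrite -sub0r; apply: bigradingB => //; exact: bigrading0. Qed.

Lemma bigradingD d u v : G d u -> G d v -> G d (u + v).
Proof. by move=> hu hv; rewrite -[v]opprK; apply/bigradingB/bigradingN. Qed.

Lemma bigrading_sum d (I : eqType) (s : seq I) (P : pred I) (F : I -> M) :
  (forall i, i \in s -> P i -> G d (F i)) -> G d (\sum_(i <- s | P i) F i).
Proof.
move=> h; rewrite big_seq_cond; elim/big_rec: _ => [|i u /andP[/h hi /hi Gi]].
  exact: bigrading0.
exact: bigradingD.
Qed.

Lemma bigradingX d mu u : G d u -> G (mnm_bideg mu + d) ('X_[mu] *: u).
Proof. by case: Ggr => _ h _ _; apply/h/bihomogX. Qed.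

Lemma bigradingC d b u : G d u -> G d (b%:MP *: u).
Proof. by rewrite -{2}[d]add0r; case: Ggr => _ h _ _; apply/h/bihomogC. Qed.

(** The list may repeat bidegrees, whereas independence in [is_bigrading] is stated for distinct
    ones; terms of equal bidegree are grouped first. *)
Lemma homog_sum_indep (l : seq ((int * int) * M)) :
  (forall x, x \in l -> G x.1 x.2) -> \sum_(x <- l) x.2 = 0 ->
  forall d, \sum_(x <- l | x.1 == d) x.2 = 0.
Proof.
move=> hl suml d; pose c e := \sum_(x <- l | x.1 == e) x.2.
have [dl|dl] := boolP (d \in map fst l); last first.
  rewrite big_seq_cond big1 // => x /andP[xl /eqP xd].
  by rewrite -xd map_f in dl.
case: Ggr => _ _ _ /(_ (undup (map fst l)) c (undup_uniq _)); apply.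
- by move=> e; apply: bigrading_sum => x xl /eqP <-; apply: hl.
- rewrite -[RHS]suml /c (exchange_big_dep xpredT) //=.
  rewrite big_seq [RHS]big_seq; apply: eq_bigr => x xl.
  under eq_bigl do rewrite eq_sym.
  rewrite -big_filter (@filter_pred1_uniq _ _ x.1) ?big_seq1 ?undup_uniq //.
  by rewrite mem_undup map_f.
- by rewrite mem_undup.
Qed.

Lemma homog_components : exists comp : int * int -> M -> M,
  [/\ forall d u v, comp d (u + v) = comp d u + comp d v,
      forall d u, G d (comp d u),
      forall d e u, G e u -> comp d u = if e == d then u else 0,
      forall d b u, comp d (b%:MP *: u) = b%:MP *: comp d u
    & forall d mu u, comp (mnm_bideg mu + d) ('X_[mu] *: u) = 'X_[mu] *: comp d u].
Proof.
have repE u : exists l : seq ((int * int) * M),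
    (forall x, x \in l -> G x.1 x.2) /\ \sum_(x <- l) x.2 = u.
  case: Ggr => _ _ /(_ u) [s [c [Gc ->]]] _.
  exists [seq (d, c d) | d <- s]; split; last by rewrite big_map.
  by move=> _ /mapP[d _ ->].
have [rep repP] := choice repE.
pose comp d u := \sum_(x <- rep u | x.1 == d) x.2.
(* The components do not depend on the chosen decomposition: the difference of two decompositions
   sums to 0. Each property then follows from a convenient decomposition. *)
have compE l u d : (forall x, x \in l -> G x.1 x.2) -> \sum_(x <- l) x.2 = u ->
    comp d u = \sum_(x <- l | x.1 == d) x.2.
  move=> hl suml; have [hr sumr] := repP u.
  have := @homog_sum_indep (rep u ++ [seq (x.1, - x.2) | x <- l]) _ _ d.
  rewrite !big_cat /= !big_map /= !sumrN suml sumr subrr => h.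
  apply/eqP; rewrite -subr_eq0; apply/eqP/h => // x.
  rewrite mem_cat => /orP[/hr //|/mapP[y yl ->]] /=.
  exact/bigradingN/hl.
exists comp; split.
- move=> d u v; have [hu su] := repP u; have [hv sv] := repP v.
  rewrite (compE (rep u ++ rep v)) ?big_cat /= ?su ?sv // => x.
  by rewrite mem_cat => /orP[/hu|/hv].
- by move=> d u; apply: bigrading_sum => x xu /eqP <-; apply: (repP u).1.
- move=> d e u Gu; rewrite (compE [:: (e, u)]) ?big_seq1 //.
    by rewrite big_cons big_nil /= addr0.
  by move=> x; rewrite inE => /eqP ->.
- move=> d b u; have [hu su] := repP u.
  rewrite (compE [seq (x.1, b%:MP *: x.2) | x <- rep u]).
  + by rewrite big_map /= scaler_sumr.
  + by move=> _ /mapP[x xu ->] /=; apply/bigradingC/hu.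
  + by rewrite big_map /= -scaler_sumr su.
- move=> d mu u; have [hu su] := repP u.
  rewrite (compE [seq (mnm_bideg mu + x.1, 'X_[mu] *: x.2) | x <- rep u]).
  + rewrite big_map /= scaler_sumr; apply: eq_bigl => x.
    by rewrite (inj_eq (addrI _)).
  + by move=> _ /mapP[x xu ->] /=; apply/bigradingX/hu.
  + by rewrite big_map /= -scaler_sumr su.
Qed.

End Components.

(** * Bidegrees under iterates of the p-linear map *)

Section GradedFrobenius.
Variables (p m n : nat) (A : comNzRingType).
Local Notation R := {mpoly A[m + n]}.
Variables (M : lmodType R) (G : int * int -> M -> Prop).
Hypothesis charR : p \in [pchar R].
Variables (theta : {linear M -> Frob p M}) (phi : M -> M).
Hypothesis theta_inj : injective theta.
Hypothesis theta_phi : forall u, theta (phi u) = tens p 1 u.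
Hypothesis Ggr : is_bigrading G.
Hypothesis theta_bideg : preserves_bideg G (@frob_bigrading m n A p M G) theta.

Let phD k := iter_phiD theta_inj theta_phi k.
Let phi_sum k (I : Type) (s : seq I) (P : pred I) (F : I -> M) :
  iter k phi (\sum_(i <- s | P i) F i) = \sum_(i <- s | P i) iter k phi (F i).
Proof. exact: (addmap_sum (phD k)). Qed.

Let phZ k := iter_phiZ theta_inj theta_phi k.

(** The graded form of [phi_span]: because [theta] preserves bidegree, the spanning terms can be
    taken homogeneous of the bidegree of v. *)
Lemma homog_phi_span k (d : int * int) (Q : M -> Prop) :
  Q 0 -> (forall u v, Q u -> Q v -> Q (u + v)) ->
  (forall b mu e u, G e u -> mnm_bideg mu + e *+ (p ^ k) = d ->
     Q (b%:MP *: ('X_[mu] *: iter k phi u))) ->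
  forall v, G d v -> Q v.
Proof.
elim: k d Q => [|k ih] d Q Q0 QD Qphi v Gv.
  have := Qphi 1 0%MM d v Gv; rewrite mpolyX0 !scale1r; apply.
  by rewrite expn0 mulr1n mnm_bideg0 add0r.
(* Rewrite u as a sum of terms a phi(w), then split a into monomials x^nu; phi^k carries x^nu to
   x^(p^k nu), which is absorbed into x^mu. *)
apply: (ih d Q) => // b mu e u Gu de.
have [j [a [w [thu aw]]]] := theta_bideg Gu.
have {thu} -> : u = \sum_i a i *: phi (w i).
  apply: theta_inj; rewrite thu linear_sum /=; apply: eq_bigr => i _.
  by rewrite (theta_scale_phi theta_phi).
rewrite phi_sum !scaler_sumr; elim/big_rec: _ => // i x _ Qx.
apply: (QD _ _ _ Qx); have [d1 [d2 [ai wi de2]]] := aw i.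
rewrite (mpoly_scaleE (a i)) phi_sum !scaler_sumr big_seq.
elim/big_rec: _ => // nu y nua Qy; apply: (QD _ _ _ Qy).
rewrite !phZ -iterSr.
have -> : 'X_[mu] *: (((a i)@_nu)%:MP ^+ (p ^ k) *:
      ('X_[nu] ^+ (p ^ k) *: iter k.+1 phi (w i)))
   = ((a i)@_nu ^+ (p ^ k))%:MP *: ('X_[mu + nu *+ (p ^ k)] *: iter k.+1 phi (w i)).
  by rewrite !scalerA mpolyXD -mpolyXn rmorphXn /=; congr (_ *: _); ring.
rewrite scalerA -mpolyCM; apply: (Qphi _ _ d2) => //.
rewrite mnm_bidegD mnm_bidegMn (ai _ nua) -addrA expnS mulrnA -mulrnDl.
by rewrite de2.
Qed.

(** That 1 (x) u has bidegree p e does not settle this at once, since directness of the grading on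
    F(M) has not been established. Instead the projection of M onto bidegree c = p e is built as an
    additive map fixing phi(u). *)
Lemma phi_bideg (e : int * int) u : G e u -> G (e *+ p) (phi u).
Proof.
move=> Gu; set c := e *+ p.
have p_gt0 : (0 < p)%N by rewrite prime_gt0 // (pcharf_prime charR).
pose quo (d : int * int) : int * int := (d.1 %/ p, d.2 %/ p)%Z.
have quoD x y : quo (x + y *+ p) = quo x + y.
  by rewrite /quo pair_mulrn; congr pair; exact: divz_addMn.
have quoM y : quo (y *+ p) = y by rewrite -[y *+ p]add0r quoD /quo !div0z add0r.
have [comp [compD Gcomp compG compC compX]] := homog_components Ggr.
(* In x^mu phi(v) only the component of v in bidegree (c - bideg mu) / p contributes to bidegree c;
   the test discards the case where p does not divide. *)
pose H (mu : 'X_{1..m + n}) v := let d := quo (c - mnm_bideg mu) in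
  if d *+ p == c - mnm_bideg mu then 'X_[mu] *: phi (comp d v) else 0.
have phD1 := phD 1; have phZ1 := phZ 1; rewrite expn1 /= in phD1 phZ1.
have [mu v w|mu b v|mu nu v|L [LD LE]] :=
    @monomial_lift p _ A M charR theta phi theta_inj theta_phi 1 M H; rewrite ?expn1.
- by rewrite /H; case: ifP; rewrite ?addr0 // compD phD1 scalerDr.
- rewrite /H; case: ifP; rewrite ?scaler0 // compC phZ1.
  by rewrite scalerA mulrC -scalerA.
- rewrite /H mnm_bidegD mnm_bidegMn opprD addrA -mulNrn quoD mulrnDl.
  rewrite (inj_eq (addIr _)); case: ifP => // _.
  set d := quo _; rewrite -{1}(subrK (mnm_bideg nu) d) addrC compX phZ1.
  by rewrite scalerA mpolyXn -mpolyXD.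
(* On spanning terms [L] is the identity in bidegree c and zero in every other one. *)
have LG d v : G d v -> G c (L v).
  move=> Gv; suff -> : L v = if d == c then v else 0.
    by case: eqP => [<-//|_]; exact: bigrading0.
  move: v Gv; apply: (@homog_phi_span 1).
  - by rewrite (addmap0 LD); case: ifP.
  - by move=> v w hv hw; rewrite LD hv hw; case: ifP => _; rewrite ?addr0.
  - move=> b mu d2 v Gv; rewrite LE expn1 => de.
    have [dc|dc] := eqVneq d c.
      by rewrite /H -dc -de addrAC subrr add0r quoM eqxx (compG _ _ _ Gv) eqxx.
    rewrite /H; case: ifP => [/eqP eqd|_]; last by rewrite scaler0.
    rewrite (compG _ _ _ Gv) ifN ?(addmap0 phD1) ?scaler0 //.
    apply: contra_neq dc => eq2.
    by rewrite -de eq2 eqd addrC subrK.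
have <- : L (phi u) = phi u.
  have := LE 1 0%MM u; rewrite mpolyX0 !scale1r /= => ->.
  by rewrite /H mnm_bideg0 subr0 quoM eqxx (compG _ _ _ Gu) eqxx mpolyX0 scale1r.
case: Ggr => _ _ /(_ (phi u)) [s [x [Gx ->]]] _.
rewrite (addmap_sum LD); apply: bigrading_sum => // i _ _.
exact: (LG i).
Qed.

Lemma iter_phi_bideg k (e : int * int) u : G e u -> G (e *+ (p ^ k)) (iter k phi u).
Proof.
move=> Gu; elim: k => [|k ih]; first by rewrite expn0 mulr1n.
by rewrite expnSr mulrnA; exact: phi_bideg.
Qed.

Lemma homog_scaleX_neq0 k (e : int * int) u (alpha : 'X_{1..m + n}) :
  G e u -> iter k phi u <> 0 -> (forall i, alpha i < p ^ k)%N ->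
  exists2 v, G (mnm_bideg alpha + e *+ (p ^ k)) v & v <> 0.
Proof.
move=> Gu u0 lt_alpha; exists ('X_[alpha] *: iter k phi u).
  apply: bigradingX => //; exact: iter_phi_bideg.
apply: contra_not u0.
exact: (scaleX_iter_phi_eq0 charR theta_inj theta_phi lt_alpha).
Qed.

Lemma homog_neq0_iter k (d : int * int) v : G d v -> v <> 0 ->
  exists e u (alpha : 'X_{1..m + n}),
    [/\ G e u, iter k phi u <> 0, forall i, (alpha i < p ^ k)%N
      & mnm_bideg alpha + e *+ (p ^ k) = d].
Proof.
set q := (p ^ k)%N => Gv v0.
have q_gt0 : (0 < q)%N by rewrite expn_gt0 prime_gt0 // (pcharf_prime charR).
apply: contrapT => nT.
case: v0; move: v Gv; apply: (@homog_phi_span k) => //.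
  by move=> u v -> ->; rewrite addr0.
move=> b mu e u Gu de.
pose alpha : 'X_{1..m + n} := [multinom (mu i %% q)%N | i < m + n].
pose nu : 'X_{1..m + n} := [multinom (mu i %/ q)%N | i < m + n].
(* Division of exponents by q moves the q-th powers inside phi^k and leaves a remainder alpha below
   q. If no admissible triple existed, every spanning term of v would vanish. *)
have mu_eq : mu = (alpha + nu *+ q)%MM.
  by apply/mnmP => i; rewrite mnmDE mulmnE !mnmE [RHS]addnC; exact: divn_eq.
have -> : 'X_[mu] *: iter k phi u = 'X_[alpha] *: iter k phi ('X_[nu] *: u).
  by rewrite phZ scalerA mpolyXn -mpolyXD -mu_eq.
suff -> : iter k phi ('X_[nu] *: u) = 0 by rewrite !scaler0.
apply: contrapT => nu0; apply: nT.
exists (mnm_bideg nu + e), ('X_[nu] *: u), alpha; split=> //.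
- exact: bigradingX.
- by move=> i; rewrite mnmE ltn_mod.
- by rewrite mulrnDl addrA -mnm_bidegMn -mnm_bidegD -mu_eq.
Qed.

End GradedFrobenius.

(** * Bidegrees attained by monomials with bounded exponents *)

Section Exponents.
Variables m n : nat.

Lemma sum_bounded l q (f : 'I_l -> nat) :
  (forall i, f i < q)%N -> (\sum_(i < l) f i <= l * q.-1)%N.
Proof.
move=> fq; apply: leq_trans (_ : (\sum_(i < l) q.-1 <= _)%N); last first.
  by rewrite sum_nat_const card_ord.
by apply: leq_sum => i _; have := fq i; lia.
Qed.

Lemma exists_bounded_sum l q s : (0 < q)%N -> (s <= l * q.-1)%N ->
  exists f : 'I_l -> nat, (forall i, f i < q)%N /\ (\sum_(i < l) f i = s)%N.
Proof.
(* Greedy filling: each slot takes up to r = q - 1 of what remains, the truncated subtraction giving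
   0 once s is used up. *)
case: q => // r _ /= sr; exists (fun i => minn r (s - i * r)); split=> [i|].
  by rewrite ltnS geq_minl.
suff -> : (\sum_(i < l) minn r (s - i * r) = minn s (l * r))%N by apply/minn_idPl.
elim: l {sr} => [|l ih]; first by rewrite big_ord0 mul0n minn0.
by rewrite big_ord_recr /= ih; lia.
Qed.

Lemma mnm_bideg_le q (alpha : 'X_{1..m + n}) : (forall i, alpha i < q)%N ->
  (0 <= (mnm_bideg alpha).1 <= (m * q.-1)%:Z) /\
  (0 <= (mnm_bideg alpha).2 <= (n * q.-1)%:Z).
Proof. by move=> lt_alpha; rewrite /= !lez_nat !sum_bounded. Qed.

Lemma exists_mnm_bideg q (s t : int) : (0 < q)%N ->
  0 <= s <= (m * q.-1)%:Z -> 0 <= t <= (n * q.-1)%:Z ->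
  exists alpha : 'X_{1..m + n}, (forall i, alpha i < q)%N /\ mnm_bideg alpha = (s, t).
Proof.
move=> q0; case: s => // s /andP[_ sm]; case: t => // t /andP[_ tn].
have [f [fq fs]] := exists_bounded_sum q0 sm.
have [g [gq gt]] := exists_bounded_sum q0 tn.
pose F (i : 'I_(m + n)) := match split i with inl i => f i | inr j => g j end.
exists [multinom F i | i < m + n]; split=> [i|].
  by rewrite mnmE /F; case: split => j; rewrite ?fq ?gq.
congr pair; congr Posz; rewrite -?fs -?gt; apply: eq_bigr => i _; rewrite mnmE /F.
  by rewrite (unsplitK (inl i)).
by rewrite (unsplitK (inr i)).
Qed.

End Exponents.

(** * Pigeonhole and windows for large powers *)

Lemma antitone_pigeonhole (T : eqType) (P : T -> nat -> Prop) (s : seq T) :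
  (forall x i j, (i <= j)%N -> P x j -> P x i) ->
  (forall k, exists2 x, x \in s & P x k) -> exists x, forall k, P x k.
Proof.
move=> anti; elim: s => [|x s ih] hs; first by case: (hs 0%N).
have [|/existsNP[k nPx]] := pselect (forall k, P x k); first by exists x.
(* Having failed at k, the head x fails at every later index, so the witness at max(i, k) lies in
   the tail. *)
apply: ih => i; have [y] := hs (maxn i k).
rewrite inE => /orP[/eqP ->|ys] Py.
  by case: nPx; apply: anti Py; rewrite leq_maxr.
by exists y => //; apply: anti Py; rewrite leq_maxl.
Qed.

(* The limit, for [q] large, of the condition [0 <= d - q e <= m (q - 1)]. *)
Definition limit_range (m : nat) (d e : int) : Prop :=
  [/\ - m%:Z <= e <= 0, d < 0 -> e < 0 & - m%:Z < d -> - m%:Z < e].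

(** The window reads q e <= d and d + m <= q (e + m). Both d and d + m have absolute value below q,
    so only their signs matter. *)
Lemma limit_rangeP (m q : nat) (d e : int) : (`|d| + m < q)%N ->
  limit_range m d e <-> 0 <= d - e *+ q <= (m * q.-1)%:Z.
Proof.
move=> dq; have q0 : (0 < q)%N by apply: leq_ltn_trans dq.
have -> : (m * q.-1)%:Z = m%:Z * q%:Z - m%:Z by rewrite -subn1 mulnBr; nia.
rewrite -mulr_natr natz /limit_range; split.
  by move=> [/andP[? ?] ? ?]; apply/andP; split; nia.
move=> /andP[? ?]; split; first (apply/andP; split); nia.
Qed.

(** * Bidegrees on which no iterate vanishes *)

Section PersistentBidegrees.
Variables (p m n : nat) (A : comNzRingType).
Local Notation R := {mpoly A[m + n]}.
Variables (M : lmodType R) (G : int * int -> M -> Prop).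
Hypothesis charR : p \in [pchar R].
Variables (theta : {linear M -> Frob p M}) (phi : M -> M).
Hypothesis theta_inj : injective theta.
Hypothesis theta_phi : forall u, theta (phi u) = tens p 1 u.
Hypothesis Ggr : is_bigrading G.
Hypothesis theta_bideg : preserves_bideg G (@frob_bigrading m n A p M G) theta.

Let p_gt1 : (1 < p)%N.
Proof. by rewrite prime_gt1 // (pcharf_prime charR). Qed.

Definition iter_phi_neq0 (e : int * int) (k : nat) : Prop :=
  exists2 u, G e u & iter k phi u <> 0.

Lemma iter_phi_neq0_anti e i j : (i <= j)%N ->
  iter_phi_neq0 e j -> iter_phi_neq0 e i.
Proof.
move=> ij [u Gu uj]; exists u => // ui; apply: uj.
rewrite -(subnK ij) iterD ui.
exact: addmap0 (iter_phiD theta_inj theta_phi _).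
Qed.

Lemma component_neq0_persistent a b : component_neq0 G a b ->
  exists e : int * int, [/\ forall k, iter_phi_neq0 e k,
    limit_range m a e.1 & limit_range n b e.2].
Proof.
move=> [v Gv v0].
pose Q (e : int * int) k :=
  [/\ iter_phi_neq0 e k, limit_range m a e.1 & limit_range n b e.2].
pose box := [seq (- i%:Z, - j%:Z) | i <- iota 0 m.+1, j <- iota 0 n.+1].
have [e i j ij [Pe ae be]|k|e Qe] := @antitone_pigeonhole _ Q box.
- by split=> //; apply: iter_phi_neq0_anti Pe.
(* This j is at least k, as antitonicity needs, and p^j exceeds the thresholds of [limit_rangeP] in
   both coordinates. *)
- pose j := maxn k (`|a| + m + `|b| + n).
  have qj : (`|a| + m + `|b| + n < p ^ j)%N.
    exact: leq_ltn_trans (leq_maxr _ _) (ltn_expl _ p_gt1).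
  have [e [u [alpha [Gu u0 lt_alpha ab]]]] :=
    homog_neq0_iter charR theta_inj theta_phi Ggr theta_bideg j Gv v0.
  have [ha hb] := mnm_bideg_le lt_alpha.
  have ea : (mnm_bideg alpha).1 = a - e.1 *+ (p ^ j).
    by have <- : _ = a := congr1 fst ab; rewrite pair_mulrn addrK.
  have eb : (mnm_bideg alpha).2 = b - e.2 *+ (p ^ j).
    by have <- : _ = b := congr1 snd ab; rewrite pair_mulrn addrK.
  rewrite ea in ha; rewrite eb in hb.
  have qa : (`|a| + m < p ^ j)%N by lia.
  have qb : (`|b| + n < p ^ j)%N by lia.
  have ra := (limit_rangeP _ qa).2 ha; have rb := (limit_rangeP _ qb).2 hb.
  exists e; last first.
    split=> //; apply: (@iter_phi_neq0_anti e k j); first exact: leq_maxl.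
    by exists u.
  apply/allpairsP; exists (`|e.1|%N, `|e.2|%N).
  case: ra => ha1 _ _; case: rb => hb1 _ _; split; rewrite ?mem_iota; cbn [fst snd]; try lia.
  by rewrite [e]surjective_pairing /=; congr pair; lia.
exists e; split=> [k||]; [by case: (Qe k)|by case: (Qe 0%N)|by case: (Qe 0%N)].
Qed.

Lemma persistent_component_neq0 (e : int * int) a b :
  (forall k, iter_phi_neq0 e k) -> limit_range m a e.1 -> limit_range n b e.2 ->
  component_neq0 G a b.
Proof.
move=> Pe ra rb; pose k := (`|a| + m + `|b| + n)%N.
have qk : (k < p ^ k)%N by apply: ltn_expl.
have qa : (`|a| + m < p ^ k)%N by rewrite /k in qk *; lia.
have qb : (`|b| + n < p ^ k)%N by rewrite /k in qk *; lia.
have [u Gu u0] := Pe k.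
have [|alpha [lt_alpha ab]] :=
  exists_mnm_bideg _ ((limit_rangeP _ qa).1 ra) ((limit_rangeP _ qb).1 rb).
  exact: leq_ltn_trans qk.
have [v Gv v0] :=
  homog_scaleX_neq0 charR theta_inj theta_phi Ggr theta_bideg Gu u0 lt_alpha.
exists v => //; move: Gv; rewrite ab pair_mulrn.
suff -> : (a - e.1 *+ p ^ k, b - e.2 *+ p ^ k) +
    (e.1 *+ p ^ k, e.2 *+ p ^ k) = (a, b) by [].
by congr pair; rewrite /= subrK.
Qed.

End PersistentBidegrees.

Theorem theoremC (p m n : nat) (K : fieldType) (A : comNzRingType)
    (iota : {rmorphism K -> A}) (charK : p \in [pchar K])
    (regA : regular_ring A) (m_gt0 : (0 < m)%N) (n_gt0 : (0 < n)%N)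
    (M : lmodType {mpoly A[m + n]}) (theta : {linear M -> Frob p M})
    (G : int * int -> M -> Prop) (hM : bigraded_F_finite theta G) :
  [/\ (1 < m)%N -> (1 < n)%N ->
        ((forall a b : int, component_neq0 G a b) <->
         (exists a0 b0 : int,
            [/\ - m%:Z < a0 < 0, - n%:Z < b0 < 0 & component_neq0 G a0 b0])),
      (1 < m)%N ->
        ((forall a b : int, 0 <= b -> component_neq0 G a b) <->
         (exists a0 b0 : int,
            [/\ - m%:Z < a0 < 0, 0 <= b0 & component_neq0 G a0 b0])),
      (1 < n)%N ->
        ((forall a b : int, a <= - m%:Z -> component_neq0 G a b) <->
         (exists a0 b0 : int,
            [/\ a0 <= - m%:Z, - n%:Z < b0 < 0 & component_neq0 G a0 b0])),
      (1 < m)%N ->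
        ((forall a b : int, b <= - n%:Z -> component_neq0 G a b) <->
         (exists a0 b0 : int,
            [/\ - m%:Z < a0 < 0, b0 <= - n%:Z & component_neq0 G a0 b0]))
    & (1 < n)%N ->
        ((forall a b : int, 0 <= a -> component_neq0 G a b) <->
         (exists a0 b0 : int,
            [/\ 0 <= a0, - n%:Z < b0 < 0 & component_neq0 G a0 b0]))].
Proof.
have charR : p \in [pchar {mpoly A[m + n]}].
  exact: (rmorph_pchar (@mpolyC (m + n) A) (rmorph_pchar iota charK)).
case: hM => -[g gK Kg] Ggr theta_bideg _.
have theta_inj := can_inj gK.
pose phi u := g (tens p 1 u).
have theta_phi u : theta (phi u) = tens p 1 u by exact: Kg.
have toP a b := @component_neq0_persistent p m n A M G charR theta phi
  theta_inj theta_phi Ggr theta_bideg a b.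
have ofP e a b := @persistent_component_neq0 p m n A M G charR theta phi
  theta_inj theta_phi Ggr theta_bideg e a b.
rewrite /limit_range in toP ofP.
(* Forward, [1 < m] or [1 < n] puts -1 strictly inside the relevant interval. Backward, take the
   persistent e: -m < a0 < 0 forces -m < e.1 < 0, which suits every a; a0 >= 0 forces -m < e.1 <= 0,
   which suits all a >= 0; a0 <= -m forces -m <= e.1 < 0, which suits all a <= -m. The second
   coordinate behaves alike. *)
split=> [m1 n1|m1|n1|m1|n1]; split=> [hall|[a0 [b0 [ha hb /toP]]]].
- by exists (-1), (-1); split; [lia|lia|exact: hall].
- case=> e [Pe [? ? ?] [? ? ?]] a b; apply: (ofP e) => //; split; lia.
- by exists (-1), 0; split; [lia| |apply: hall].
- case=> e [Pe [? ? ?] [? ? ?]] a b ?; apply: (ofP e) => //; split; lia.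
- by exists (- m%:Z), (-1); split; [|lia|apply: hall].
- case=> e [Pe [? ? ?] [? ? ?]] a b ?; apply: (ofP e) => //; split; lia.
- by exists (-1), (- n%:Z); split; [lia| |apply: hall].
- case=> e [Pe [? ? ?] [? ? ?]] a b ?; apply: (ofP e) => //; split; lia.
- by exists 0, (-1); split; [|lia|apply: hall].
- case=> e [Pe [? ? ?] [? ? ?]] a b ?; apply: (ofP e) => //; split; lia.
Qed.
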